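(* Let $\varphi$ be a formula of $\mathrm{SL}( *,\mathrm{reach}^+)$ built over the variables $x_1,\dots,x_q$. For all $\alpha\ge\mathrm{msize}(\varphi)$ and all memory states $(s,h)$, $(s',h')$ with $(s,h)\approx^q_\alpha(s',h')$, we have $(s,h)\models\varphi$ iff $(s',h')\models\varphi$.
   Context: A memory state is $(s,h)$ with $s:\mathrm{PVAR}\to\mathrm{LOC}$ (program variables $x_1,x_2,\dots$) and $h$ a partial function $\mathrm{LOC}\to\mathrm{LOC}$ with finite domain. $h^0=\mathrm{id}$, $h^{n+1}(l)=h(h^n(l))$ when defined. $\mathrm{SL}( *,\mathrm{reach}^+)$ has atoms $x=y$, $x\hookrightarrow y$, $\mathrm{emp}$, $\mathrm{reach}^+(x,y)$ and connectives $\neg,\wedge,*$: $(s,h)\models x=y$ iff $s(x)=s(y)$; $\mathrm{emp}$ iff $\mathrm{dom}(h)=\emptyset$; $x\hookrightarrow y$ iff $s(x)\in\mathrm{dom}(h)$, $h(s(x))=s(y)$; $\mathrm{reach}^+(x,y)$ iff $h^i(s(x))=s(y)$ for some $i\ge1$; $\varphi_1*\varphi_2$ iff $h=h_1+h_2$ with disjoint domains, $(s,h_1)\models\varphi_1$, $(s,h_2)\models\varphi_2$. Memory size: $\mathrm{msize}$ of an atom is $1$, $\mathrm{msize}(\neg\psi)=\mathrm{msize}(\psi)$, $\mathrm{msize}(\psi\wedge\psi')=\max(\mathrm{msize}(\psi),\mathrm{msize}(\psi'))$, $\mathrm{msize}(\psi*\psi')=\mathrm{msize}(\psi)+\mathrm{msize}(\psi')$.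 Terms: $\mathrm{Terms}_q=\{x_1,\dots,x_q\}\cup\{m_q(x_i,x_j)\mid i,j\le q\}$. $[\![x_i]\!]^q_{s,h}=s(x_i)$; $[\![m_q(x_i,x_j)]\!]^q_{s,h}$ is the unique location $l$ (undefined if none) such that there are $L_1,L_2\ge0$ with $h^{L_1}(s(x_i))=h^{L_2}(s(x_j))=l$, for all $L_1'<L_1$ and $L_2'\ge0$, $h^{L_1'}(s(x_i))\neq h^{L_2'}(s(x_j))$, and there are $k\le q$, $L\ge0$ with $h^L(l)=s(x_k)$. $\mathrm{Labels}_q(s,h)$ is the set of defined values $[\![t]\!]^q_{s,h}$. Support graph of $(s,h)$: $V=\mathrm{Labels}_q(s,h)$; $(l,l')\in E$ iff $l,l'\in V$, there is $L\ge1$ with $h^L(l)=l'$ and $h^{L'}(l)\notin V$ for $0<L'<L$; $A=V\cap\mathrm{dom}(h)$; $\mathrm{Lab}(l)=\{t\mid[\![t]\!]^q_{s,h}=l\}$; for $(l,l')\in E$, $\mathrm{Btw}(l,l')$ is the set of $l''$ with $L,L'\ge1$, $h^L(l)=l''$, $h^{L'}(l'')=l'$ and $h^{L''}(l)\notin V$ for all $L''\in[1,L]$; $\mathrm{Rem}=\mathrm{dom}(h)\setminus(A\cup\bigcup_{(l,l')\in E}\mathrm{Btw}(l,l'))$. $\mathrm{Test}(q,\alpha)$: formulas $t=t'$, $\mathrm{alloc}(t)$, $t\hookrightarrow t'$, $\mathrm{sees}_q(t,t')\ge\beta+1$, $\mathrm{sizeR}_q\ge\beta$ ($t,t'\in\mathrm{Terms}_q$,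 $\beta\in\{1,\dots,\alpha\}$) with semantics: $t=t'$ iff some $l\in V$ has $\{t,t'\}\subseteq\mathrm{Lab}(l)$; $\mathrm{alloc}(t)$ iff some $l\in A$ has $t\in\mathrm{Lab}(l)$; $t\hookrightarrow t'$ iff some $(l,l')\in E$ has $t\in\mathrm{Lab}(l)$, $t'\in\mathrm{Lab}(l')$, $\mathrm{Btw}(l,l')=\emptyset$; $\mathrm{sees}_q(t,t')\ge\beta+1$ iff some $(l,l')\in E$ has $t\in\mathrm{Lab}(l)$, $t'\in\mathrm{Lab}(l')$, $|\mathrm{Btw}(l,l')|\ge\beta$; $\mathrm{sizeR}_q\ge\beta$ iff $|\mathrm{Rem}|\ge\beta$. $(s,h)\approx^q_\alpha(s',h')$ iff both satisfy exactly the same formulas of $\mathrm{Test}(q,\alpha)$. *)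

(* Defs.v *)
From mathcomp Require Import all_boot finmap.
From mathcomp Require Import boolp classical_sets functions cardinality.

Set Implicit Arguments.
Unset Strict Implicit.
Unset Printing Implicit Defensive.

Local Open Scope classical_set_scope.

(* The program variable written x_{i+1} on paper is represented by its index
   i, so that x_1, ..., x_q are exactly the indices i < q. *)
Definition pvar : Type := nat.

Definition store (LOC : choiceType) : Type := pvar -> LOC.
Definition heap (LOC : choiceType) : Type := {fmap LOC -> LOC}.

Definition hiter (LOC : choiceType) (h : heap LOC) (n : nat) (l : LOC) :
    option LOC :=
  iter n (obind (fun l' : LOC => h.[? l']%fmap)) (Some l).

Definition dom (LOC : choiceType) (h : heap LOC) : set LOC :=
  [set l | l \in domf h].

Inductive form : Type :=
| FEq of pvar & pvar
| FPto of pvar & pvar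
| FEmp
| FReach of pvar & pvar
| FNot of form
| FAnd of form & form
| FStar of form & form.

Fixpoint built_over (q : nat) (phi : form) : bool :=
  match phi with
  | FEq x y | FPto x y | FReach x y => (x < q) && (y < q)
  | FEmp => true
  | FNot psi => built_over q psi
  | FAnd psi1 psi2 | FStar psi1 psi2 => built_over q psi1 && built_over q psi2
  end.

Fixpoint msize (phi : form) : nat :=
  match phi with
  | FEq _ _ | FPto _ _ | FEmp | FReach _ _ => 1
  | FNot psi => msize psi
  | FAnd psi1 psi2 => maxn (msize psi1) (msize psi2)
  | FStar psi1 psi2 => msize psi1 + msize psi2
  end.

(* The union [h1 + h2] of finite maps is right-biased in general; on disjoint
   domains it is the disjoint union. *)
Fixpoint sat (LOC : choiceType) (s : store LOC) (h : heap LOC) (phi : form) :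
    Prop :=
  match phi with
  | FEq x y => s x = s y
  | FPto x y => h.[? s x]%fmap = Some (s y)
  | FEmp => dom h = set0
  | FReach x y => exists2 i, 1 <= i & hiter h i (s x) = Some (s y)
  | FNot psi => ~ sat s h psi
  | FAnd psi1 psi2 => sat s h psi1 /\ sat s h psi2
  | FStar psi1 psi2 => exists h1 h2 : heap LOC,
      [/\ [disjoint domf h1 & domf h2]%fset, h = (h1 + h2)%fset,
          sat s h1 psi1 & sat s h2 psi2]
  end.

Inductive term (q : nat) : Type :=
| TVar of 'I_q
| TMeet of 'I_q & 'I_q.

(* In the second conjunct [hiter h M1 (s i)] is always defined, because
   M1 < L1; the inequality in [option LOC] is thus the intended one even when
   [hiter h M2 (s j)] is undefined. *)
Definition is_meet (LOC : choiceType) (q : nat) (s : store LOC) (h : heap LOC)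
    (i j : 'I_q) (l : LOC) : Prop :=
  (exists L1 L2, [/\ hiter h L1 (s i) = Some l, hiter h L2 (s j) = Some l &
     forall M1 M2, M1 < L1 -> hiter h M1 (s i) <> hiter h M2 (s j)]) /\
  (exists (k : 'I_q) L, hiter h L l = Some (s k)).

Lemma is_meet_uniq (LOC : choiceType) (q : nat) (s : store LOC) (h : heap LOC)
    (i j : 'I_q) (l l' : LOC) :
  is_meet s h i j l -> is_meet s h i j l' -> l = l'.
Proof.
move=> [[L1 [L2 [e1 e2 m]]] _] [[M1 [M2 [f1 f2 n]]] _].
case: (ltngtP L1 M1) => c.
- by case: (n L1 L2 c); rewrite e1 e2.
- by case: (m M1 M2 c); rewrite f1 f2.
- by move: e1; rewrite c f1 => -[].
Qed.

Definition tval (LOC : choiceType) (q : nat) (s : store LOC) (h : heap LOC)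
    (t : term q) : option LOC :=
  match t with
  | TVar i => Some (s i)
  | TMeet i j =>
      match pselect (exists l, is_meet s h i j l) with
      | left e => Some (projT1 (cid e))
      | right _ => None
      end
  end.

Lemma tval_meetP (LOC : choiceType) (q : nat) (s : store LOC) (h : heap LOC)
    (i j : 'I_q) (l : LOC) :
  tval s h (TMeet i j) = Some l <-> is_meet s h i j l.
Proof.
rewrite /tval; case: pselect => [e|ne]; last by split=> // ml; case: ne; exists l.
case: (cid e) => l' /= ml'; split=> [[<-] //|ml].
by congr Some; apply: is_meet_uniq ml' ml.
Qed.

Definition labels (LOC : choiceType) (q : nat) (s : store LOC) (h : heap LOC) :
    set LOC :=
  [set l | exists t : term q, tval s h t = Some l].

Definition sgE (LOC : choiceType) (q : nat) (s : store LOC) (h : heap LOC) :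
    set (LOC * LOC) :=
  [set e | [/\ labels q s h e.1, labels q s h e.2 &
     exists L, [/\ 1 <= L, hiter h L e.1 = Some e.2 &
       forall M m, 0 < M < L -> hiter h M e.1 = Some m -> ~ labels q s h m]]].

Definition sgA (LOC : choiceType) (q : nat) (s : store LOC) (h : heap LOC) :
    set LOC :=
  labels q s h `&` dom h.

Definition sgLab (LOC : choiceType) (q : nat) (s : store LOC) (h : heap LOC)
    (l : LOC) : set (term q) :=
  [set t | tval s h t = Some l].

Definition sgBtw (LOC : choiceType) (q : nat) (s : store LOC) (h : heap LOC)
    (l l' : LOC) : set LOC :=
  [set l'' | exists L L', [/\ 1 <= L, 1 <= L', hiter h L l = Some l'',
     hiter h L' l'' = Some l' &
     forall M m, 1 <= M <= L -> hiter h M l = Some m -> ~ labels q s h m]].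

Definition sgRem (LOC : choiceType) (q : nat) (s : store LOC) (h : heap LOC) :
    set LOC :=
  dom h `\` (sgA q s h `|` \bigcup_(e in sgE q s h) sgBtw q s h e.1 e.2).

(* [KSees t t' b] stands for "sees_q(t, t') >= b + 1" and [KSizeR b] for
   "sizeR_q >= b". *)
Inductive test (q : nat) : Type :=
| KEq of term q & term q
| KAlloc of term q
| KPto of term q & term q
| KSees of term q & term q & nat
| KSizeR of nat.

Definition Test (q alpha : nat) : set (test q) :=
  [set k | match k with
           | KSees _ _ b | KSizeR b => 1 <= b <= alpha : Prop
           | _ => True
           end].

(* [`I_b] is {0, ..., b - 1}, so [`I_b #<= X] says that X has at least b
   elements. *)
Definition test_sat (LOC : choiceType) (q : nat) (s : store LOC) (h : heap LOC)
    (k : test q) : Prop :=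
  match k with
  | KEq t t' => exists2 l, labels q s h l & sgLab s h l t /\ sgLab s h l t'
  | KAlloc t => exists2 l, sgA q s h l & sgLab s h l t
  | KPto t t' => exists l l', [/\ sgE q s h (l, l'), sgLab s h l t,
      sgLab s h l' t' & sgBtw q s h l l' = set0]
  | KSees t t' b => exists l l', [/\ sgE q s h (l, l'), sgLab s h l t,
      sgLab s h l' t' & (`I_b #<= sgBtw q s h l l')%card]
  | KSizeR b => (`I_b #<= sgRem q s h)%card
  end.

Definition test_equiv (LOC : choiceType) (q alpha : nat)
    (s : store LOC) (h : heap LOC) (s' : store LOC) (h' : heap LOC) : Prop :=
  forall k : test q, Test alpha k -> (test_sat s h k <-> test_sat s' h' k).

(* Main.v *)
(* Mark the labels of the support graph.  A heap is then cut into the marked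
   cells, the unmarked cells strictly between consecutive marked locations, and
   the rest; test equivalence says that two heaps are cut along the same graph
   with the same cardinalities up to the threshold.  Labels are closed under
   meets, so the pieces are disjoint.  When the heap is split, the same marked
   locations are kept, although some of them are no longer labels: an edge
   survives in a part exactly when all its cells lie there, and the cells of a
   broken edge move to the rest.  A split of one heap is therefore copied on
   the other by splitting each piece in matching proportions, each part with
   its share of the threshold, and the theorem follows by induction on the
   formula. *)
From mathcomp Require Import all_boot finmap zify.
From mathcomp Require Import boolp classical_sets cardinality.
Require Import Defs.

Set Implicit Arguments.
Unset Strict Implicit.
Unset Printing Implicit Defensive.

(** * Iteration of a heap, paths and subheaps *)

Section Iteration.
Variable LOC : choiceType.
Implicit Types (h : heap LOC) (x y z : LOC) (p : seq LOC).

Lemma hiterS h n x : hiter h n.+1 x = obind (fnd h) (hiter h n x).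
Proof. by []. Qed.

Lemma hiterD h m n x y : hiter h n x = Some y ->
  hiter h (m + n) x = hiter h m y.
Proof.
move=> e; elim: m => [|m IH]; first by rewrite add0n e.
by rewrite addSn !hiterS IH.
Qed.

Lemma hiter_sub h m n x y z : hiter h m x = Some y -> hiter h n x = Some z ->
  m <= n -> hiter h (n - m) y = Some z.
Proof. by move=> e f le; rewrite -f -{2}(subnK le) (hiterD _ e). Qed.

Lemma hiter_prefix h m n x z : hiter h n x = Some z -> m <= n ->
  exists y, hiter h m x = Some y.
Proof.
elim: n z => [|n IH] z e; first by rewrite leqn0 => /eqP->; exists x.
rewrite leq_eqVlt => /orP[/eqP->|]; first by exists z.
rewrite ltnS; move: e; rewrite hiterS; case e: hiter => [y|] // _.
exact: IH e.
Qed.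

Lemma hiter_lt_dom h m n x y z : hiter h m x = Some y -> hiter h n x = Some z ->
  m < n -> y \in domf h.
Proof.
move=> e f lt; have [w] := hiter_prefix f lt.
by rewrite hiterS e /=; case: fndP.
Qed.

Lemma hiter_mul h N x k : hiter h N x = Some x -> hiter h (k * N) x = Some x.
Proof. by move=> e; elim: k => [|k IH] //; rewrite mulSn (hiterD _ IH). Qed.

Definition step h : rel LOC := fun x y => fnd h x == Some y.

Lemma path_hiter h x p n : path (step h) x p -> n <= size p ->
  hiter h n x = Some (nth x (x :: p) n).
Proof.
move=> /(pathP x) P; elim: n => [|n IH] // le.
by rewrite hiterS (IH (ltnW le)) /=; apply/eqP/P.
Qed.

Definition subheap h1 h :=
  forall x, x \in domf h1 -> fnd h1 x = fnd h x.

Lemma subheap_dom h1 h x : subheap h1 h -> x \in domf h1 -> x \in domf h.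
Proof.
move=> sub x1; rewrite -[_ \in _](@fndSome _ _ h) -sub //.
by rewrite fndSome.
Qed.

Lemma subheap_hiter h1 h n x y : subheap h1 h ->
  hiter h1 n x = Some y -> hiter h n x = Some y.
Proof.
move=> sub; elim: n y => [|n IH] y //; rewrite !hiterS.
case e: hiter => [z|] //= e1; rewrite (IH _ e) /= -sub //.
by case: fndP e1.
Qed.

Lemma subheap_path h1 h x p y : subheap h1 h ->
  all [in domf h1] (x :: p) -> path (step h) x (rcons p y) ->
  path (step h1) x (rcons p y).
Proof.
move=> sub; elim: p x => [|z p IH] x /= /andP[x1 al] /andP[e P];
  by rewrite /step sub // -/(step h x _) e ?IH.
Qed.

End Iteration.

(** * Counting in lists and equality of numbers up to a threshold *)

Lemma uniq_flatten_disjoint (T : eqType) (J : eqType) (g : J -> seq T)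
    (os : seq J) :
  uniq os -> (forall o, uniq (g o)) ->
  (forall o o' x, x \in g o -> x \in g o' -> o = o') ->
  uniq (flatten [seq g o | o <- os]).
Proof.
move=> + gu gd; elim: os => [|o os IH] //= /andP[no uos].
rewrite cat_uniq gu IH // andbT /=; apply/hasPn => x.
move=> /flatten_mapP[o' o'os xo']; apply/negP => xo.
by move: no; rewrite (gd _ _ _ xo xo') o'os.
Qed.

Lemma count_take (T : eqType) (r : seq T) k : uniq r -> k <= size r ->
  count [in take k r] r = k.
Proof.
move=> u le; rewrite -{2}(cat_take_drop k r) count_cat.
have /eqP-> : count [in take k r] (take k r) == size (take k r).
  by rewrite -all_count; apply/allP.
have /eqP-> : count [in take k r] (drop k r) == 0.
  rewrite -leqn0 leqNgt -has_count; move: u.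
  by rewrite -{1}(cat_take_drop k r) cat_uniq => /and3P[].
by rewrite addn0 size_takel.
Qed.

Lemma count_complement (T : eqType) (A B : pred T) (r : seq T) :
  {in r, forall x, B x = ~~ A x} -> count B r = size r - count A r.
Proof.
by move=> H; rewrite (eq_in_count H) -(count_predC A r) addKn.
Qed.

(** Equivalently, [m] and [n] are equal or both at least [a]; the form with [minn] is open to linear
    arithmetic. *)
Definition eq_upto (a m n : nat) := minn a m = minn a n.

Lemma eq_upto_sym a m n : eq_upto a m n -> eq_upto a n m.
Proof. by rewrite /eq_upto => ->. Qed.

(** It suffices to try the truncated values [minn a m] and [minn a n] as [b]. *)
Lemma eq_upto_geq a m n :
  (forall b, 1 <= b <= a -> (b <= m <-> b <= n)) -> eq_upto a m n.
Proof.
rewrite /eq_upto => H; have [/H|] := boolP (1 <= minn a m <= a); last first.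
  have [/H|] := boolP (1 <= minn a n <= a); lia.
have [/H|] := boolP (1 <= minn a n <= a); lia.
Qed.

(** If [n] and [n'] differ, both are at least [a1 + a2]. A part below its share of the threshold is
    then copied exactly and the other part absorbs the difference; if both parts reach their shares,
    [a1] goes to the first and at least [a2] remains. *)
Lemma eq_upto_split a1 a2 n n' k : eq_upto (a1 + a2) n n' -> k <= n ->
  exists k', [/\ k' <= n', eq_upto a1 k k' & eq_upto a2 (n - k) (n' - k')].
Proof.
rewrite /eq_upto => e le.
case: (leqP a1 k) => c1; last by exists k; split; lia.
case: (leqP a2 (n - k)) => c2; last by exists (n' - (n - k)); split; lia.
by case: (eqVneq n n') => [<-|ne]; [exists k|exists a1]; split; lia.
Qed.

Lemma eq_upto_sumn (J : Type) a (F F' : J -> nat) (os : seq J) :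
  (forall o, eq_upto a (F o) (F' o)) ->
  eq_upto a (sumn [seq F o | o <- os]) (sumn [seq F' o | o <- os]).
Proof.
move=> H; elim: os => [|o os IH] //=; move: (H o) IH; rewrite /eq_upto; lia.
Qed.

Lemma eq_upto_nil a (T : Type) (r r' : seq T) : 0 < a ->
  eq_upto a (size r) (size r') -> r = [::] -> r' = [::].
Proof.
rewrite /eq_upto => a0 e r0; apply/nilP; move: e.
by rewrite /nilp r0 /=; lia.
Qed.

(** * Heaps cut along marked locations *)

(* [v] enumerates marked locations, [nx i] is the first marked location met
   strictly after [v i], [g (Some i)] lists the cells strictly in between, and
   [g None] lists all remaining cells.  The marked locations may be any finite
   set for which the lists [g] do not overlap; unlike the set of labels, such
   a set stays admissible in every subheap. *)
Record frame (LOC : choiceType) (I : finType) (v : I -> LOC)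
    (nx : I -> option I) (g : option I -> seq LOC) (h : heap LOC) : Prop :=
  Frame {
  frame_inj : injective v;
  frame_edge : forall i j, nx i = Some j ->
    path (step h) (v i) (rcons (g (Some i)) (v j));
  frame_noedge : forall i, nx i = None -> g (Some i) = [::];
  frame_stop : forall i j L, nx i = None -> 0 < L ->
    hiter h L (v i) <> Some (v j);
  frame_off : forall o i, v i \notin g o;
  frame_dom : forall o x, x \in g o -> x \in domf h;
  frame_cover : forall x, x \in domf h ->
    (exists i, x = v i) \/ (exists o, x \in g o);
  frame_uniq : forall o, uniq (g o);
  frame_disj : forall o o' x, x \in g o -> x \in g o' -> o = o' }.

Section FrameTheory.
Variables (LOC : choiceType) (I : finType) (v : I -> LOC).
Variables (nx : I -> option I) (g : option I -> seq LOC) (h : heap LOC).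
Hypothesis fr : frame v nx g h.

Lemma frame_hiter_gap i j n : nx i = Some j -> n <= size (g (Some i)) ->
  hiter h n (v i) = Some (nth (v i) (v i :: g (Some i)) n).
Proof.
move=> e le; rewrite (path_hiter (frame_edge fr e)) ?size_rcons ?leqW //.
by rewrite -rcons_cons nth_rcons /= ltnS le.
Qed.

Lemma frame_hiter_next i j : nx i = Some j ->
  hiter h (size (g (Some i))).+1 (v i) = Some (v j).
Proof.
move=> e; rewrite (path_hiter (frame_edge fr e)) ?size_rcons //.
by rewrite -rcons_cons nth_rcons /= ltnn eqxx.
Qed.

(** Cells of a gap are unmarked, so a walk ending in a marked location has run through the whole
    gap. *)
Lemma frame_hiter_marked i k L : 0 < L -> hiter h L (v i) = Some (v k) ->
  exists2 j, nx i = Some j & size (g (Some i)) < L.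
Proof.
move=> L0 e; case ei: (nx i) => [j|]; last by case: (frame_stop fr ei L0 e).
exists j => //; rewrite ltnNge; apply/negP => le.
case: L L0 le e => // L _ le; rewrite (frame_hiter_gap ei le) /= => -[e].
by move: (frame_off fr (Some i) k); rewrite -e mem_nth.
Qed.

Lemma frame_pto i k :
  (fnd h (v i) = Some (v k)) <-> (nx i = Some k /\ g (Some i) = [::]).
Proof.
split=> [e|[e e0]]; last first.
  by have := frame_hiter_next e; rewrite e0.
have e1 : hiter h 1 (v i) = Some (v k) by [].
have [j ej] := frame_hiter_marked (ltn0Sn 0) e1.
rewrite ltnS leqn0 => /nilP e0; split => //.
have := frame_hiter_next ej; rewrite e0 e1 => -[] /(frame_inj fr) ->.
by [].
Qed.

(** A walk between marked locations is a concatenation of full gaps, so reachability depends on [nx]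
    alone and not on the sizes of the gaps. *)
Lemma frame_reach i k :
  (exists2 n, 1 <= n & hiter h n (v i) = Some (v k)) <->
  (exists2 n, 1 <= n & iter n (obind nx) (Some i) = Some k).
Proof.
split=> -[n n1 e]; last first.
  elim: n n1 k e => // n IH _ k.
  rewrite iterS; case e: (iter n _ _) => [j|] //= ek.
  case: n IH e => [_ [->]|n IH e].
    by exists (size (g (Some j))).+1 => //; apply: frame_hiter_next.
  have [m m1 em] := IH (ltn0Sn _) _ e.
  exists ((size (g (Some j))).+1 + m); first lia.
  by rewrite (hiterD _ em); apply: frame_hiter_next.
elim/ltn_ind: n i n1 e => n IH i n1 e.
have [j ej lt] := frame_hiter_marked n1 e.
have en := frame_hiter_next ej.
have /= e' := hiter_sub en e lt.
have [e0|n0] := posnP (n - (size (g (Some i))).+1).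
  by exists 1 => //=; rewrite ej; move: e'; rewrite e0 => -[] /(frame_inj fr) ->.
have [|m m1 em] := IH _ _ j n0 e'; first lia.
exists m.+1 => //; rewrite iterSr /= ej.
by [].
Qed.

Lemma frame_emp : (domf h = fset0) <->
  (forall i, v i \notin domf h) /\ (forall o, g o = [::]).
Proof.
split=> [e|[v0 g0]].
  split=> [i|o]; first by rewrite e inE.
  by case eo: (g o) (@frame_dom _ _ _ _ _ _ fr o) => [|x r] // /(_ x);
    rewrite e inE eqxx => /(_ isT).
apply/fsetP => x; rewrite in_fset0; apply/negbTE/negP => xh.
have [[i e]|[o]] := frame_cover fr xh; last by rewrite g0.
by move: (v0 i); rewrite -e xh.
Qed.

Definition kept (h1 : heap LOC) (i : I) :=
  all [in domf h1] (v i :: g (Some i)).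

Definition loose h1 (o : option I) := if o is Some i then ~~ kept h1 i else true.

Definition sub_nx h1 (i : I) := if kept h1 i then nx i else None.

(** Since [None] is always loose, the new rest collects the cells of [h1] from the former rest and
    from the broken gaps. *)
Definition sub_gap h1 (o : option I) :=
  if o is Some i then (if kept h1 i then g (Some i) else [::])
  else [seq x <- flatten [seq g o | o <- enum {: option I} & loose h1 o]
          | x \in domf h1].

Lemma mem_sub_gap_None h1 x : x \in sub_gap h1 None ->
  exists2 o, loose h1 o & x \in g o.
Proof.
rewrite mem_filter => /andP[_ /flatten_mapP[o]].
by rewrite mem_filter => /andP[lo _]; exists o.
Qed.

Lemma size_sub_gap_None h1 : size (sub_gap h1 None) =
  sumn [seq (if loose h1 o then count [in domf h1] (g o) else 0)
         | o <- enum {: option I}].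
Proof.
rewrite size_filter count_flatten -map_comp.
elim: (enum _) => //= o os <-; case: ifP => //.
Qed.

Lemma frame_subheap h1 : subheap h1 h ->
  frame v (sub_nx h1) (sub_gap h1) h1.
Proof.
move=> sub; split.
- exact: frame_inj fr.
- move=> i j; rewrite /sub_nx /sub_gap; case: ifP => // k e.
  exact: subheap_path sub k (frame_edge fr e).
- move=> i; rewrite /sub_nx /sub_gap; case: ifP => // _.
  exact: (frame_noedge fr).
- move=> i j L; rewrite /sub_nx => nk L0 e1.
  (* A walk in [h1] to a marked location is also a walk in [h], hence runs through the whole gap of
     [i]. It therefore passes through the missing cell [x] and goes on, which puts [x] in [h1]. *)
  have [k ek lt] := frame_hiter_marked L0 (subheap_hiter sub e1).
  move: nk; rewrite ek; case: ifP => // /negbT /allPn[x xi x1] _.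
  case/negP: x1; have ix := xi; rewrite -index_mem /= in ix.
  have [|y ey] := @hiter_prefix _ h1 (index x (v i :: g (Some i))) _ _ _ e1.
    by apply: leq_trans lt; rewrite leqW.
  have := frame_hiter_gap ek (ix : index x (v i :: g (Some i)) <= _).
  rewrite (subheap_hiter sub ey) nth_index // => -[<-].
  by apply: hiter_lt_dom ey e1 _; apply: leq_trans lt.
- move=> [i|] j.
    by rewrite /sub_gap; case: ifP => // _; apply: (frame_off fr).
  by apply/negP => /mem_sub_gap_None[o _]; apply/negP/(frame_off fr).
- move=> [i|] x; last by rewrite mem_filter => /andP[].
  by rewrite /sub_gap; case: ifP => // /allP k xg; apply: k; rewrite inE xg orbT.
- move=> x x1; have [[i e]|[o xo]] := frame_cover fr (subheap_dom sub x1).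
    by left; exists i.
  right; have [lo|] := boolP (loose h1 o).
    exists None; rewrite mem_filter x1 /=; apply/flatten_mapP; exists o => //.
    by rewrite mem_filter lo mem_enum.
  case: o xo => [i|] //= xi /negPn k; exists (Some i).
  by rewrite /sub_gap k.
- move=> [i|]; first by rewrite /sub_gap; case: ifP => // _; apply: (frame_uniq fr).
  apply: filter_uniq; apply: uniq_flatten_disjoint.
  + by apply: filter_uniq; apply: enum_uniq.
  + exact: frame_uniq fr.
  + exact: frame_disj fr.
- have aux i x : x \in sub_gap h1 (Some i) -> kept h1 i /\ x \in g (Some i).
    by rewrite /sub_gap; case: ifP.
  move=> [i|] [j|] x //.
  + by move=> /aux[_ xi] /aux[_]; apply: (frame_disj fr).
  + move=> /aux[k xi] /mem_sub_gap_None[o lo xo].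
    by move: lo; rewrite -(frame_disj fr xi xo) /= k.
  + move=> /mem_sub_gap_None[o lo xo] /aux[k xi].
    by move: lo; rewrite -(frame_disj fr xi xo) /= k.
Qed.

End FrameTheory.

(** * Transfer of satisfaction along matching frames *)

(** [I], [nx] and [var] are shared: both heaps have the same abstract graph, with the variables at
    the same vertices. Allocation is compared separately, since an allocated marked cell need not
    lead to a marked location. *)
Definition sim (LOC : choiceType) (q a : nat) (s : store LOC) (h : heap LOC)
    (s' : store LOC) (h' : heap LOC) : Prop :=
  exists (I : finType) (v v' : I -> LOC) (nx : I -> option I)
      (g g' : option I -> seq LOC) (var : 'I_q -> I),
    [/\ frame v nx g h /\ frame v' nx g' h',
        forall x : 'I_q, s x = v (var x) /\ s' x = v' (var x),
        forall i, (v i \in domf h) = (v' i \in domf h') &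
        forall o, eq_upto a (size (g o)) (size (g' o))].

Section Simulation.
Variables (LOC : choiceType) (q : nat).
Implicit Types (s : store LOC) (h : heap LOC).

Lemma sim_sym a s h s' h' : sim q a s h s' h' -> sim q a s' h' s h.
Proof.
move=> [I [v [v' [nx [g [g' [var [[f f'] sv al sz]]]]]]]].
exists I, v', v, nx, g', g, var; split=> //.
- by move=> x; have [] := sv x.
- by move=> o; apply: eq_upto_sym.
Qed.

Lemma sim_eq a s h s' h' (x y : 'I_q) : sim q a s h s' h' ->
  s x = s y -> s' x = s' y.
Proof.
move=> [I [v [v' [nx [g [g' [var [[f f'] sv al sz]]]]]]]].
have [-> ->] := sv x; have [-> ->] := sv y.
by move=> /(frame_inj f) ->.
Qed.

Lemma sim_pto a s h s' h' (x y : 'I_q) : 0 < a -> sim q a s h s' h' ->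
  fnd h (s x) = Some (s y) -> fnd h' (s' x) = Some (s' y).
Proof.
move=> a0 [I [v [v' [nx [g [g' [var [[f f'] sv al sz]]]]]]]].
have [-> ->] := sv x; have [-> ->] := sv y.
move=> /(frame_pto f)[e e0]; apply/(frame_pto f'); split=> //.
exact: eq_upto_nil a0 (sz _) e0.
Qed.

Lemma sim_reach a s h s' h' (x y : 'I_q) : sim q a s h s' h' ->
  (exists2 n, 1 <= n & hiter h n (s x) = Some (s y)) ->
  exists2 n, 1 <= n & hiter h' n (s' x) = Some (s' y).
Proof.
move=> [I [v [v' [nx [g [g' [var [[f f'] sv al sz]]]]]]]].
have [-> ->] := sv x; have [-> ->] := sv y.
by move=> /(frame_reach f) /(frame_reach f').
Qed.

Lemma sim_emp a s h s' h' : 0 < a -> sim q a s h s' h' ->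
  domf h = fset0 -> domf h' = fset0.
Proof.
move=> a0 [I [v [v' [nx [g [g' [var [[f f'] sv al sz]]]]]]]].
move=> /(frame_emp f)[v0 g0]; apply/(frame_emp f'); split=> [i|o].
  by rewrite -al.
exact: eq_upto_nil a0 (sz _) (g0 _).
Qed.

(** The same edges break on both sides, so both new rests sum the counts over the same pieces, and
    [eq_upto] is stable under sums. *)
Lemma sim_subheap a s h s' h' h1 h1' (I : finType) (v v' : I -> LOC)
    (nx : I -> option I) (g g' : option I -> seq LOC) (var : 'I_q -> I) :
  frame v nx g h -> frame v' nx g' h' ->
  (forall x : 'I_q, s x = v (var x) /\ s' x = v' (var x)) ->
  subheap h1 h -> subheap h1' h' ->
  (forall i, (v i \in domf h1) = (v' i \in domf h1')) ->
  (forall i, kept v g h1 i = kept v' g' h1' i) ->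
  (forall o, eq_upto a (count [in domf h1] (g o)) (count [in domf h1'] (g' o))) ->
  sim q a s h1 s' h1'.
Proof.
move=> f f' sv sub sub' al ke ct.
exists I, v, v', (sub_nx v nx g h1), (sub_gap v g h1), (sub_gap v' g' h1'), var.
split=> //.
- split; first exact: frame_subheap f _ sub.
  have -> : sub_nx v nx g h1 = sub_nx v' nx g' h1'.
    by apply: funext => i; rewrite /sub_nx ke.
  exact: frame_subheap f' _ sub'.
- move=> [i|].
    rewrite /sub_gap -ke; case: ifP => // k; have k' := k; rewrite ke in k'.
    move: k k' (ct (Some i)); rewrite /kept /= => /andP[_ k] /andP[_ k'].
    by move: k k'; rewrite !all_count => /eqP-> /eqP->.
  rewrite !size_sub_gap_None; apply: eq_upto_sumn => o.
  have -> : loose v' g' h1' o = loose v g h1 o by case: o => //= i; rewrite ke.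
  by case: ifP.
Qed.

Lemma subheap_catl h1 h2 : [disjoint domf h1 & domf h2]%fset ->
  subheap h1 (h1 + h2)%fset.
Proof. by move=> /fdisjointP d x /d xn; rewrite fnd_cat (negbTE xn). Qed.

Lemma subheap_catr h1 h2 : subheap h2 (h1 + h2)%fset.
Proof. by move=> x x2; rewrite fnd_cat x2. Qed.

Lemma sim_split a1 a2 s h s' h' h1 h2 : 0 < a1 -> 0 < a2 ->
  [disjoint domf h1 & domf h2]%fset -> h = (h1 + h2)%fset ->
  sim q (a1 + a2) s h s' h' ->
  exists h1' h2', [/\ [disjoint domf h1' & domf h2']%fset,
    h' = (h1' + h2')%fset, sim q a1 s h1 s' h1' & sim q a2 s h2 s' h2'].
Proof.
move=> a10 a20 dj eh [I [v [v' [nx [g [g' [var [[f f'] sv al sz]]]]]]]].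
have sub1 : subheap h1 h by rewrite eh; apply: subheap_catl.
have sub2 : subheap h2 h by rewrite eh; apply: subheap_catr.
have dom2 x : x \in domf h -> (x \in domf h2) = (x \notin domf h1).
  move=> xh; apply/idP/idP; first by apply/fdisjointP; rewrite fdisjoint_sym.
  by move: xh; rewrite eh domf_cat in_fsetU => /orP[->|].
(* [k' o] is the number of cells of the piece [g' o] that go to the first part. *)
have [k' k'P] := choice (fun o =>
  eq_upto_split (sz o) (count_size [in domf h1] (g o))).
(* Only the number of cells taken from a piece matters, so the first ones are taken; marked cells
   follow their counterparts in [h]. *)
pose D : {fset LOC} := seq_fset tt ([seq v' i | i <- enum I & v i \in domf h1] ++
  flatten [seq take (k' o) (g' o) | o <- enum {: option I}]).
have Dv i : (v' i \in D) = (v i \in domf h1).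
  rewrite seq_fsetE mem_cat mem_map; last exact: frame_inj f'.
  rewrite mem_filter mem_enum andbT orbC; case: flatten_mapP => // -[o _].
  by move=> /mem_take; rewrite (negbTE (frame_off f' o i)).
have Dg o x : x \in g' o -> (x \in D) = (x \in take (k' o) (g' o)).
  move=> xo; rewrite seq_fsetE mem_cat; case: mapP => [[i _ e]|_] /=.
    by move: (frame_off f' o i); rewrite -e xo.
  apply/flatten_mapP/idP => [[o' _ xo']|xt]; last by exists o; rewrite ?mem_enum.
  by rewrite (frame_disj f' xo (mem_take xo')).
exists h'.[& D]%fmap, h'.[\ D]%fmap.
have d1 x : x \in domf h' -> (x \in domf h'.[& D]%fmap) = (x \in D).
  by move=> xh; rewrite domf_restrict in_fsetI xh andbT.
have d2 x : x \in domf h' -> (x \in domf h'.[\ D]%fmap) = (x \notin D).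
  by move=> xh; rewrite domf_rem in_fsetD xh andbT.
have c1 o : count [in domf h'.[& D]%fmap] (g' o) = k' o.
  have [le _ _] := k'P o; rewrite -[RHS](count_take (frame_uniq f' o) le).
  by apply: eq_in_count => x xo; rewrite /= d1 ?(Dg _ _ xo) ?(frame_dom f' xo).
have c2 o : count [in domf h'.[\ D]%fmap] (g' o) = size (g' o) - k' o.
  rewrite -c1; apply: count_complement => x /(frame_dom f') xh.
  by rewrite /= d1 // d2.
have c2h o : count [in domf h2] (g o) = size (g o) - count [in domf h1] (g o).
  by apply: count_complement => x /(frame_dom f) xh; rewrite /= dom2.
have v1 i : (v i \in domf h1) = (v' i \in domf h'.[& D]%fmap).
  rewrite domf_restrict in_fsetI Dv -al.
  by case: (boolP (v i \in domf h1)) => // /(subheap_dom sub1) ->.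
have v2 i : (v i \in domf h2) = (v' i \in domf h'.[\ D]%fmap).
  rewrite domf_rem in_fsetD Dv -al andbC.
  case: (boolP (v i \in domf h)) => [/dom2 //|/negP n].
  by apply/negbTE/negP => /(subheap_dom sub2).
split.
- apply/fdisjointP => x; rewrite domf_restrict domf_rem in_fsetI in_fsetD.
  by move=> /andP[->].
- apply/fmapP => x; rewrite fnd_cat fnd_rem fnd_restrict domf_rem in_fsetD.
  by case: (x \in D) => //=; case: (boolP (x \in domf h')) => // /not_fnd.
- apply: (sim_subheap f f' sv sub1 _ v1).
  + by move=> x; rewrite fnd_restrict domf_restrict in_fsetI => /andP[->].
  (* As [a2] is positive, the second part misses [g o] exactly when it misses [g' o]; so the same
     gaps lie entirely in the first part. For the second part, [a1] is used in the same way. *)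
  + move=> i; rewrite /kept /= v1 !all_count c1; congr (_ && _).
    have [] := k'P (Some i); have := count_size [in domf h1] (g (Some i)).
    rewrite /eq_upto; lia.
  + by move=> o; rewrite c1; have [] := k'P o.
- apply: (sim_subheap f f' sv sub2 _ v2).
  + by move=> x; rewrite fnd_rem domf_rem in_fsetD => /andP[/negbTE->].
  + move=> i; rewrite /kept /= v2 !all_count c2 c2h; congr (_ && _).
    have [] := k'P (Some i); have := count_size [in domf h1] (g (Some i)).
    rewrite /eq_upto; lia.
  + by move=> o; rewrite c2 c2h; have [] := k'P o.
Qed.

(** Each factor of a separating conjunction thus receives a positive threshold, enough to tell an
    empty gap from a nonempty one. *)
Lemma msize_gt0 phi : 0 < msize phi.
Proof. by elim: phi => //= psi IH psi' IH'; lia. Qed.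

(** One implication suffices because [sim] is symmetric; the states are generalised so that negation
    can exchange them. *)
Lemma sim_sat phi a s h s' h' : built_over q phi -> msize phi <= a ->
  sim q a s h s' h' -> sat s h phi -> sat s' h' phi.
Proof.
elim: phi a h h' s s' => /=.
- move=> x y a h h' s s' /andP[xq yq] _ S.
  exact: (sim_eq (x := Ordinal xq) (y := Ordinal yq) S).
- move=> x y a h h' s s' /andP[xq yq] a0 S.
  exact: (sim_pto (x := Ordinal xq) (y := Ordinal yq) a0 S).
- move=> a h h' s s' _ a0 S e.
  have -> // : dom h' = set0.
  have e0 : domf h = fset0.
    apply/fsetP => x; rewrite in_fset0; apply/negP => xh.
    by have : dom h x by []; rewrite e.
  by rewrite /dom (sim_emp a0 S e0); apply/seteqP; split.
- move=> x y a h h' s s' /andP[xq yq] a0 S.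
  exact: (sim_reach (x := Ordinal xq) (y := Ordinal yq) S).
- move=> psi IH a h h' s s' b le S n p; apply: n.
  exact: IH b le (sim_sym S) p.
- move=> psi1 IH1 psi2 IH2 a h h' s s' /andP[b1 b2]; rewrite geq_max.
  by move=> /andP[le1 le2] S [p1 p2]; split; [apply: IH1 S p1|apply: IH2 S p2].
- move=> psi1 IH1 psi2 IH2 a h h' s s' /andP[b1 b2] le S [h1 [h2 [dj e p1 p2]]].
  have le1 : msize psi1 <= a by lia.
  have le2 : msize psi2 <= a - msize psi1 by lia.
  (* The first factor gets exactly its memory size as threshold, the second what is left of [a]. *)
  rewrite -(subnKC le1) in S.
  have [h1' [h2' [dj' e' S1 S2]]] :=
    sim_split (msize_gt0 psi1) (leq_trans (msize_gt0 psi2) le2) dj e S.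
  exists h1', h2'; split=> //; first exact: IH1 S1 p1.
  exact: IH2 S2 p2.
Qed.

End Simulation.

(** * Closure of labels under meets, and the cells of an edge *)

Section Labels.
Variables (LOC : choiceType) (q : nat) (s : store LOC) (h : heap LOC).
Implicit Types (x y z l u : LOC).

Definition reaches x y := exists n, hiter h n x = Some y.

Lemma reaches_trans y x z : reaches x y -> reaches y z -> reaches x z.
Proof. by move=> [m e] [n f]; exists (n + m); rewrite (hiterD _ e). Qed.

(** After [m] steps from [x] to [y], another [m * N - m] steps complete [m] turns of the cycle. *)
Lemma reaches_cycle x y : (exists2 N, 0 < N & hiter h N x = Some x) ->
  reaches x y -> reaches y x.
Proof.
move=> [N N0 e] [m f]; exists (m * N - m).
by apply: hiter_sub f (hiter_mul m e) _; rewrite leq_pmulr.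
Qed.

Lemma labels_from_var l : labels q s h l ->
  exists (i : 'I_q) n, hiter h n (s i) = Some l.
Proof.
move=> [[i [<-]|i j /tval_meetP[[m [n [e _ _]]] _]]]; first by exists i, 0.
by exists i, m.
Qed.

Lemma labels_to_var l : labels q s h l -> exists k : 'I_q, reaches l (s k).
Proof.
move=> [[i [<-]|i j /tval_meetP[_ [k [L e]]]]]; first by exists i, 0.
by exists k, L.
Qed.

Lemma labels_var (i : 'I_q) : labels q s h (s i).
Proof. by exists (TVar i). Qed.

Lemma labels_first_common (i j k : 'I_q) n l : hiter h n (s i) = Some l ->
  reaches (s j) l -> reaches l (s k) ->
  (forall m x, m < n -> hiter h m (s i) = Some x -> ~ reaches (s j) x) ->
  labels q s h l.
Proof.
move=> e [m f] [r t] first; exists (TMeet i j); apply/tval_meetP; split.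
  exists n, m; split=> // m1 m2 lt em.
  have [x ex] := hiter_prefix e (ltnW lt).
  by apply: (first _ _ lt ex); exists m2; rewrite -em.
by exists k, r.
Qed.

(** Let [l1] and [l2] lie on the walks from [s i] and [s j]. Then [p] is [l1] or [l2], or the first
    common location of the walks from [s i] and [s k] if [l1] reaches [l2], or else that of the
    walks from [s i] and [s j]. *)
Lemma labels_meet_closed l1 l2 p n (k : 'I_q) :
  labels q s h l1 -> labels q s h l2 -> hiter h n l1 = Some p ->
  reaches l2 p -> reaches p (s k) ->
  (forall m x, m < n -> hiter h m l1 = Some x -> ~ reaches l2 x) ->
  labels q s h p.
Proof.
move=> lab1 lab2 e l2p pk first.
case: n e first => [[<-] //|n] e first.
have l21 : ~ reaches l2 l1 by apply: (first 0).
have [i [a ea]] := labels_from_var lab1.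
have [j [b eb]] := labels_from_var lab2.
have ep : hiter h (n.+1 + a) (s i) = Some p by rewrite (hiterD _ ea).
case: (pselect (reaches l1 l2)) => [[m em]|l12].
  (* [p] and [l2] lie on a common cycle, which also contains [s k]. *)
  have le : n < m.
    rewrite ltnNge; apply/negP => le; apply: (first _ _ (le : m < n.+1) em).
    by exists 0.
  have epl := hiter_sub e em le.
  have [eq0|gt0] := posnP (m - n.+1).
    by move: epl; rewrite eq0 => -[->].
  have [r er] := l2p.
  have kp : reaches (s k) p.
    apply: reaches_cycle pk; exists (r + (m - n.+1)); first lia.
    by rewrite (hiterD _ epl).
  have l2k := reaches_trans l2p pk.
  apply: (labels_first_common ep kp pk) => c x lt ex kx.
  have l2x := reaches_trans l2k kx.
  case: (leqP a c) => ac.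
    by apply: (first (c - a) x _ (hiter_sub ea ex ac) l2x); lia.
  apply: l21; apply: reaches_trans l2x _; exists (a - c).
  exact: hiter_sub ex ea (ltnW ac).
(* Neither of [l1] and [l2] reaches the other here. An earlier common location of the walks from
   [s i] and [s j] would either come after both [l1] and [l2], against [first], or let one of them
   reach the other. *)
have jp : reaches (s j) p by apply: reaches_trans l2p; exists b.
apply: (labels_first_common ep jp pk) => c x lt ex [d ed].
case: (leqP a c) => ac.
  have ex1 := hiter_sub ea ex ac.
  case: (leqP b d) => bd.
    apply: (first (c - a) x _ ex1); first lia.
    by exists (d - b); apply: hiter_sub eb ed bd.
  apply: l12; apply: (reaches_trans (y := x)); first by exists (c - a).
  by exists (b - d); apply: hiter_sub ed eb (ltnW bd).
have ex1 := hiter_sub ex ea (ltnW ac).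
have ej : hiter h (a - c + d) (s j) = Some l1 by rewrite (hiterD _ ed).
case: (leqP b (a - c + d)) => le.
  by apply: l21; eexists; apply: hiter_sub eb ej le.
by apply: l12; eexists; apply: hiter_sub ej eb (ltnW le).
Qed.

Definition unlabelled_walk l n u := hiter h n l = Some u /\
  forall m x, 1 <= m <= n -> hiter h m l = Some x -> ~ labels q s h x.

(** The first cell on the walk from [l1] that [l2] reaches is a label by closure under meets; past
    its start the walk has no label, so this cell is [l1]. *)
Lemma walks_reach l1 l2 u n1 n2 (k : 'I_q) :
  labels q s h l1 -> labels q s h l2 ->
  unlabelled_walk l1 n1 u -> unlabelled_walk l2 n2 u -> reaches u (s k) ->
  reaches l2 l1.
Proof.
move=> lab1 lab2 [e1 w1] [e2 w2] uk.
pose P n := `[< exists2 x, hiter h n l1 = Some x & reaches l2 x >].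
have exP : exists n, P n by exists n1; apply/asboolP; exists u => //; exists n2.
case: (ex_minnP exP) => n /asboolP[p ep l2p] minn.
have le : n <= n1 by apply: minn; apply/asboolP; exists u => //; exists n2.
have lp : labels q s h p.
  apply: (labels_meet_closed (k := k) lab1 lab2 ep l2p).
    by apply: reaches_trans uk; exists (n1 - n); apply: hiter_sub ep e1 le.
  move=> m x lt ex l2x; have := minn m; rewrite leqNgt lt.
  by move=> H; suff: false by []; apply: H; apply/asboolP; exists x.
case: n ep le {minn} => [[->] //|n] ep le.
by case: (w1 n.+1 p _ ep).
Qed.

(* Distinct labels with a common unlabelled successor would lie on one cycle,
   where [h] is injective. *)
Lemma walks_eq l1 l2 u n1 n2 (k : 'I_q) :
  labels q s h l1 -> labels q s h l2 ->
  unlabelled_walk l1 n1 u -> unlabelled_walk l2 n2 u -> reaches u (s k) ->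
  l1 = l2.
Proof.
wlog le : l1 l2 n1 n2 / n1 <= n2.
  move=> H lab1 lab2 w1 w2 uk; case: (leqP n1 n2) => le.
    exact: H le lab1 lab2 w1 w2 uk.
  by symmetry; apply: H (ltnW le) lab2 lab1 w2 w1 uk.
move=> lab1 lab2 w1 w2 uk.
have [n en] := walks_reach lab1 lab2 w1 w2 uk.
have l12 := walks_reach lab2 lab1 w2 w1 uk.
case: w1 w2 => e1 w1 [e2 w2].
case: (leqP n n2) => nle.
  case: n en nle => [[] //|n] en nle.
  by case: (w2 n.+1 l1 nle en).
(* Here [u] leads back to [l1]. The cell [w] on the walk from [l2] is, like [l1], [n1] steps before
   [u], so [n - n2 + n1] steps lead from [w] to [l1]. They also lead from [w] to [w], being a period
   of the cycle through [l1]; hence [w] is [l1]. *)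
have eu := hiter_sub e2 en (ltnW nle).
have [w ew] := hiter_prefix e2 (leq_subr n1 n2).
have ewu : hiter h n1 w = Some u.
  by have := hiter_sub ew e2 (leq_subr n1 n2); rewrite subKn.
have [r er] : reaches l1 w by apply: reaches_trans l12 _; exists (n2 - n1).
have e11 : hiter h (n - n2 + n1) l1 = Some l1 by rewrite (hiterD _ e1).
have ew1 : hiter h (n - n2 + n1) w = Some l1 by rewrite (hiterD _ ewu).
have [wl] : Some w = Some l1.
  by rewrite -ew1 -(hiterD _ er) addnC (hiterD _ e11) er.
have [e0|gt0] := posnP (n2 - n1); first by move: ew; rewrite e0 wl => -[].
have ngt : 1 <= n2 - n1 <= n2 by rewrite gt0 leq_subr.
by case: (w2 _ _ ngt ew); rewrite wl.
Qed.

Lemma sgE_gap l l' : sgE q s h (l, l') -> exists p,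
  [/\ path (step h) l (rcons p l'), forall x, x \in p -> ~ labels q s h x,
      uniq p & forall x, x \in p <-> sgBtw q s h l l' x].
Proof.
move=> [/= lab lab' [L [L1 eL nolab]]].
(* The walk is defined up to [L], so the default [l] never appears in that range. *)
pose F n := odflt l (hiter h n l).
have FE n : n <= L -> hiter h n l = Some (F n).
  by move=> le; have [y ey] := hiter_prefix eL le; rewrite /F ey.
have FL : F L = l' by rewrite /F eL.
have Fno n : 0 < n < L -> ~ labels q s h (F n).
  by move=> lt; apply: (nolab _ _ lt); apply: FE; lia.
have LE : L.-1.+1 = L by rewrite prednK.
exists (mkseq (fun n => F n.+1) L.-1).
have memF x : x \in mkseq (fun n => F n.+1) L.-1 ->
    exists2 n, 0 < n < L & x = F n.
  by move=> /mapP[n]; rewrite mem_iota => lt ->; exists n.+1 => //; lia.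
split.
- have -> : rcons (mkseq (fun n => F n.+1) L.-1) l' = mkseq (fun n => F n.+1) L.
    by rewrite -[in RHS]LE mkseqS LE FL.
  apply/(pathP l) => n; rewrite size_mkseq => lt; rewrite nth_mkseq //.
  have -> : nth l (l :: mkseq (fun n => F n.+1) L) n = F n.
    by case: n lt => [|n] lt //=; rewrite nth_mkseq // ltnW.
  by have := FE _ lt; rewrite hiterS FE ?(ltnW lt) //= => /eqP.
- by move=> x /memF[n lt ->]; apply: Fno.
- apply/mkseq_uniqP => m n; rewrite !inE.
  (* A repeated cell would let the walk skip a loop and meet the label [l'] before step [L]. *)
  have main a b : a < b -> b < L.-1 -> F a.+1 <> F b.+1.
    move=> ab bL e; have ea : hiter h a.+1 l = Some (F a.+1) by apply: FE; lia.
    have eb : hiter h b.+1 l = Some (F a.+1) by rewrite e; apply: FE; lia.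
    have eL' : hiter h (L - b.+1) (F a.+1) = Some l'.
      by apply: hiter_sub eb eL _; lia.
    have eab : hiter h (L - b.+1 + a.+1) l = Some l' by rewrite (hiterD _ ea).
    by apply: (nolab _ _ _ eab lab'); lia.
  by move=> mL nL e; case: (ltngtP m n) => // lt; [case: (main m n)|case: (main n m)].
- move=> x; split=> [/memF[n lt ->]|].
    exists n, (L - n); split.
    + by case/andP: lt.
    + by lia.
    + by apply: FE; lia.
    + by apply: hiter_sub eL _; [apply: FE|]; lia.
    + by move=> m y mn; apply: nolab; lia.
  move=> [K [K' [K1 K'1 eK _ noK]]].
  (* Otherwise the label [l'] would be met within the first [K] steps. *)
  have KL : K < L.
    by rewrite ltnNge; apply/negP => le; apply: (noK L l') => //; rewrite L1.
  apply/mapP; exists K.-1; first by rewrite mem_iota; lia.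
  by rewrite prednK //; move: eK; rewrite FE ?(ltnW KL) // => -[].
Qed.

End Labels.

Lemma card_geq_size (T : choiceType) (X : set T) (p : seq T) b : uniq p ->
  (forall x, x \in p <-> X x) -> (`I_b #<= X)%card <-> b <= size p.
Proof.
move=> u pX; have -> : X = [set` seq_fset tt p]%classic.
  apply/seteqP; split=> x; rewrite /mkset seq_fsetE; first by move/pX.
  by move/pX.
have /card_eq_fsetP c : #|` seq_fset tt p| = size p.
  by rewrite size_seq_fset undup_id.
by rewrite (card_le_eqr c) card_le_II.
Qed.

(** * The frame whose marked locations are the labels *)

Section CanonicalFrame.
Variables (LOC : choiceType) (q : nat) (s : store LOC) (h : heap LOC).
Variables (I : finType) (v : I -> LOC) (nx : I -> option I).
Hypothesis v_inj : injective v.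
Hypothesis v_labels : forall x, labels q s h x <-> exists i, x = v i.
Hypothesis nxP : forall i j, nx i = Some j <-> sgE q s h (v i, v j).

Lemma canonical_frame : exists g, [/\ frame v nx g h,
  forall i j, nx i = Some j ->
    forall x, x \in g (Some i) <-> sgBtw q s h (v i) (v j) x &
  forall x, x \in g None <-> sgRem q s h x].
Proof.
have v_lab i : labels q s h (v i) by apply/v_labels; exists i.
pose gapP i p := if nx i is Some j then
  [/\ path (step h) (v i) (rcons p (v j)), forall x, x \in p -> ~ labels q s h x,
      uniq p & forall x, x \in p <-> sgBtw q s h (v i) (v j) x] else p = [::].
have [g0 g0P] : {g0 : I -> seq LOC & forall i, gapP i (g0 i)}.
  apply: choice => i; rewrite /gapP; case e: (nx i) => [j|]; last by exists [::].
  by apply: sgE_gap; apply/nxP.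
pose r : seq LOC := [seq x <- domf h | `[< sgRem q s h x >]].
pose g o := if o is Some i then g0 i else r.
have gap i x : x \in g0 i -> exists2 j, nx i = Some j & sgBtw q s h (v i) (v j) x.
  move=> xi; have := g0P i; rewrite /gapP; case e: (nx i) => [j|]; last first.
    by move=> e0; rewrite e0 in xi.
  by move=> [_ _ _ /(_ x)[H _]]; exists j => //; apply: H.
have rP x : x \in r <-> sgRem q s h x.
  rewrite mem_filter; split=> [/andP[/asboolP //]|H].
  by apply/andP; split; [apply/asboolP|case: H].
have gap_nolab i x : x \in g0 i -> ~ labels q s h x.
  move=> xi; have := g0P i; rewrite /gapP; case e: (nx i) => [j|]; last first.
    by move=> e0; rewrite e0 in xi.
  by move=> [_ H _ _]; apply: H.
have gap_rem i x : x \in g0 i -> ~ sgRem q s h x.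
  move=> /gap[j e xb] [_]; apply; right.
  by exists (v i, v j) => //; apply/nxP.
exists g; split=> //; last first.
  by move=> i j e x; have := g0P i; rewrite /gapP e => -[].
split=> //.
- by move=> i j e; have := g0P i; rewrite /gapP e => -[].
- by move=> i e; have := g0P i; rewrite /gapP e.
- move=> i j L e L0 eL.
  (* The first label met after [v i] would be the end of an edge leaving [v i]. *)
  pose P n := (0 < n) && `[< exists2 x, hiter h n (v i) = Some x & labels q s h x >].
  have exP : exists n, P n.
    by exists L; rewrite /P L0; apply/asboolP; exists (v j).
  case: (ex_minnP exP) => n /andP[n0 /asboolP[x ex lx]] minn.
  have [k ek] := (v_labels x).1 lx.
  suff : nx i = Some k by rewrite e.
  apply/nxP; split=> //=; exists n; split=> //; first by rewrite -ek.
  move=> m y /andP[m0 mn] ey ly.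
  have : n <= m by apply: minn; rewrite /P m0; apply/asboolP; exists y.
  by rewrite leqNgt mn.
- move=> [i|] j; apply/negP; first by move/gap_nolab; apply.
  move=> /rP[vd]; apply; left; split=> //.
- move=> [i|] x; last by rewrite mem_filter => /andP[].
  move=> /gap[j _ [L [L' [_ L'1 _ e _]]]].
  exact: (@hiter_lt_dom _ h 0 L' x x (v j)).
- move=> x xh; case: (pselect (exists i, x = v i)) => [|nv]; first by left.
  right; case: (pselect (sgRem q s h x)) => [/rP xr|nr]; first by exists None.
  case: (pselect (exists i, x \in g0 i)) => [[i xi]|ng]; first by exists (Some i).
  case: nr; split=> //; case=> [[/v_labels //]|[[l l'] E B]].
  apply: ng; have [/= /v_labels[i ei] /v_labels[j ej] _] := E; exists i.
  rewrite /= ei ej in E B; have /nxP e := E.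
  by have := g0P i; rewrite /gapP e => -[_ _ _ ->].
- move=> [i|]; last by apply: filter_uniq; apply: fset_uniq.
  by have := g0P i; rewrite /gapP /=; case: (nx i) => [j []|->].
- move=> [i|] [i'|] x //=.
  + move=> /gap[j _ [L [L' [L1 L'1 e e' nl]]]] /gap[j' _ [M [M' [M1 M'1 f f' nl']]]].
    have [k jk] := labels_to_var (v_lab j).
    congr Some; apply: v_inj.
    (* Both gaps give unlabelled walks to [x], and [x] reaches a variable through the label [v j];
       so the two walks start at the same label. *)
    apply: (@walks_eq _ q s h _ _ x L M k) => //.
    by apply: reaches_trans jk; exists L'.
  + by move=> /gap_rem H /rP.
  + by move=> /rP H /gap_rem.
Qed.

End CanonicalFrame.

(** * From test equivalence to matching frames *)

Section TestEquivalence.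
Variables (LOC : choiceType) (q : nat).
Implicit Types (s : store LOC) (h : heap LOC).

(** As a finite set, the labels supply the [finType] of vertices that [sim] asks for. *)
Definition label_fset s h : {fset LOC} :=
  seq_fset tt ([seq s i | i : 'I_q] ++
    pmap (fun ij : 'I_q * 'I_q => tval s h (TMeet ij.1 ij.2)) (enum predT)).

Lemma label_fsetP s h x : x \in label_fset s h <-> labels q s h x.
Proof.
rewrite seq_fsetE mem_cat mem_pmap; split=> [/orP[]/mapP[i _ e]|].
- by exists (TVar i); rewrite e.
- by exists (TMeet i.1 i.2).
move=> [[i [<-]|i j e]]; apply/orP; first by left; rewrite map_f ?mem_enum.
by right; apply/mapP; exists (i, j); rewrite ?mem_enum.
Qed.

Lemma test_eqP s h (t t' : term q) : test_sat s h (KEq t t') <->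
  exists2 l, tval s h t = Some l & tval s h t' = Some l.
Proof.
split=> [[l _ [e e']]|[l e e']]; first by exists l.
by exists l => //; exists t.
Qed.

(** An edge is detected by [KPto] if nothing lies in between and by [KSees] with bound 1 otherwise;
    [0 < a] makes the latter test available. *)
Lemma test_edge_transfer a s h s' h' (t t' : term q) l1 l2 l1' l2' : 0 < a ->
  test_equiv q a s h s' h' ->
  tval s h t = Some l1 -> tval s h t' = Some l2 ->
  tval s' h' t = Some l1' -> tval s' h' t' = Some l2' ->
  sgE q s h (l1, l2) -> sgE q s' h' (l1', l2').
Proof.
move=> a0 te e1 e2 e1' e2' E.
have [p [_ _ u pB]] := sgE_gap E.
have [p0|p0] := posnP (size p).
  have K : test_sat s h (KPto t t').
    exists l1, l2; split=> //; apply/seteqP; split=> // x /pB.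
    by rewrite (size0nil p0).
  have /= [m [m' [E' + + _]]] := (te (KPto t t') Logic.I).1 K.
  by rewrite /sgLab /= e1' e2' => -[->] [->].
have K : test_sat s h (KSees t t' 1).
  by exists l1, l2; split=> //; apply/(card_geq_size _ u pB).
have T1 : Test a (KSees t t' 1) by rewrite /Test /= a0.
have /= [m [m' [E' + + _]]] := (te _ T1).1 K.
by rewrite /sgLab /= e1' e2' => -[->] [->].
Qed.

Lemma test_equiv_sym a s h s' h' :
  test_equiv q a s h s' h' -> test_equiv q a s' h' s h.
Proof. by move=> te k Tk; split=> /(te k Tk). Qed.

(** Labels of the two heaps are matched through the terms denoting them. The equality tests make
    this matching a well-defined bijection; the other tests carry over edges, allocation and
    truncated sizes. *)
Lemma test_equiv_sim a s h s' h' : 0 < a ->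
  test_equiv q a s h s' h' -> sim q a s h s' h'.
Proof.
move=> a0 te; have te' := test_equiv_sym te.
pose J : finType := label_fset s h; pose v : J -> LOC := val.
have T_ex (i : J) : exists t : term q, tval s h t = Some (v i).
  by have /label_fsetP := valP i.
have [T TP] := choice T_ex.
have v'_ex (i : J) : exists l, tval s' h' (T i) = Some l.
  have [|l e _] := (test_eqP s' h' (T i) (T i)).1; last by exists l.
  by apply: (te (KEq _ _) Logic.I).1; apply/test_eqP; exists (v i).
have [v' vP'] := choice v'_ex.
have eqT (t t' : term q) l l' : tval s h t = Some l -> tval s h t' = Some l ->
    tval s' h' t = Some l' -> tval s' h' t' = Some l'.
  move=> e1 e2 e'; have [|m f f'] := (test_eqP s' h' t t').1.
    by apply: (te (KEq _ _) Logic.I).1; apply/test_eqP; exists l.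
  by rewrite f' -e' f.
have v_inj : injective v by apply: val_inj.
have v'_inj : injective v'.
  move=> i j e; apply: v_inj.
  have [|m] := (test_eqP s h (T i) (T j)).1.
    by apply: (te' (KEq _ _) Logic.I).1; apply/test_eqP; exists (v' i); rewrite ?vP' ?e.
  by rewrite !TP => -[->] [->].
have v_lab x : labels q s h x <-> exists i, x = v i.
  split=> [/label_fsetP xl|[i ->]]; first by exists [` xl]%fset.
  by exists (T i).
have v'_lab x : labels q s' h' x <-> exists i, x = v' i.
  split=> [[t e]|[i ->]]; last by exists (T i).
  have [|l el _] := (test_eqP s h t t).1.
    by apply: (te' (KEq _ _) Logic.I).1; apply/test_eqP; exists x.
  have [i ei] : exists i, l = v i by apply/v_lab; exists t.
  exists i; have := eqT t (T i) _ _ el; rewrite TP ei => /(_ _ erefl e).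
  by rewrite vP' => -[].
(* Read off the first heap only; [nxP'] shows that it describes the edges of the second as well. *)
pose nx i := [pick j : J | `[< sgE q s h (v i, v j) >]].
have E_uniq i j k : sgE q s h (v i, v j) -> sgE q s h (v i, v k) -> j = k.
  move=> [/= _ lj [L [L1 e nl]]] [/= _ lk [M [M1 f nm]]].
  apply: v_inj; case: (ltngtP L M) => c.
  - by case: (nm L (v j) _ e lj); rewrite L1.
  - by case: (nl M (v k) _ f lk); rewrite M1.
  - by move: e; rewrite c f => -[].
have nxP i j : nx i = Some j <-> sgE q s h (v i, v j).
  rewrite /nx; case: pickP => [k /asboolP Ek|no].
    by split=> [[<-] //|Ej]; rewrite (E_uniq _ _ _ Ek Ej).
  by split=> // Ej; move: (no j) => /asboolP.
have nxP' i j : nx i = Some j <-> sgE q s' h' (v' i, v' j).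
  rewrite nxP; split.
    exact: (test_edge_transfer a0 te (TP i) (TP j) (vP' i) (vP' j)).
  exact: (test_edge_transfer a0 te' (vP' i) (vP' j) (TP i) (TP j)).
have [g [fr gB gR]] := canonical_frame v_inj v_lab nxP.
have [g' [fr' gB' gR']] := canonical_frame v'_inj v'_lab nxP'.
have var_ex (x : 'I_q) : exists i, s x = v i by apply/v_lab/labels_var.
have [var varP] := choice var_ex.
exists J, v, v', nx, g, g', var; split=> //.
- move=> x; split; first exact: varP.
  have := eqT (TVar x) (T (var x)) (s x) (s' x) erefl.
  by rewrite TP varP => /(_ erefl erefl); rewrite vP' => -[].
- move=> i; apply/idP/idP => d.
    have [|l [_ ld]] := (te (KAlloc (T i)) Logic.I).1.
      by exists (v i) => //; split=> //; apply/v_lab; exists i.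
    by rewrite /sgLab /= vP' => -[->].
  have [|l [_ ld]] := (te' (KAlloc (T i)) Logic.I).1.
    by exists (v' i) => //; split=> //; apply/v'_lab; exists i.
  by rewrite /sgLab /= TP => -[->].
- move=> [i|]; last first.
    apply: eq_upto_geq => b ba; have Tb : Test a (KSizeR q b) by [].
    rewrite -(card_geq_size b (frame_uniq fr None) gR).
    by rewrite -(card_geq_size b (frame_uniq fr' None) gR'); apply: te Tb.
  case e: (nx i) => [j|]; last by rewrite (frame_noedge fr e) (frame_noedge fr' e).
  apply: eq_upto_geq => b ba; have Tb : Test a (KSees (T i) (T j) b) by [].
  rewrite -(card_geq_size b (frame_uniq fr (Some i)) (gB _ _ e)).
  rewrite -(card_geq_size b (frame_uniq fr' (Some i)) (gB' _ _ e)).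
  split=> K.
    have [|l [l' [_ + + K']]] := (te _ Tb).1.
      by exists (v i), (v j); split=> //; apply/nxP.
    by rewrite /sgLab /= !vP' => -[->] [->].
  have [|l [l' [_ + + K']]] := (te' _ Tb).1.
    by exists (v' i), (v' j); split=> //; apply/nxP'.
  by rewrite /sgLab /= !TP => -[->] [->].
Qed.

End TestEquivalence.

Theorem theorem4p9 (LOC : choiceType) (q : nat) (phi : form)
    (hphi : built_over q phi) (alpha : nat) (halpha : msize phi <= alpha)
    (s : store LOC) (h : heap LOC) (s' : store LOC) (h' : heap LOC)
    (heq : test_equiv q alpha s h s' h') :
  sat s h phi <-> sat s' h' phi.
Proof.
have S := test_equiv_sim (leq_trans (msize_gt0 phi) halpha) heq.
by split; [apply: sim_sat hphi halpha S|apply: sim_sat hphi halpha (sim_sym S)].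
Qed.
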